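(* Let $G=(V,E)$ be a finite directed graph. Then the set $\mathrm{pas}_{\mathrm{min}}(G)$ of all non-empty minimal passages of $G$ is a passage partitioning of $G$.
   Context: A directed graph is a pair $G=(V,E)$ with $E\subseteq V\times V$; finite means $V$ is finite. A set $P\subseteq E$ is a passage of $G$ if for every $(x,y)\in P$ and all $x',y'\in V$ with $(x,y')\in E$ and $(x',y)\in E$, we have $(x,y')\in P$ and $(x',y)\in P$. A passage $P$ is minimal if there is no non-empty passage $P'$ of $G$ with $P'\subsetneq P$. A passage partitioning of $G$ is a finite set $\mathcal P=\{P_1,\dots,P_n\}$ of non-empty passages of $G$ such that $\bigcup_{i=1}^n P_i=E$ and $P_i\cap P_j=\emptyset$ for all $1\le i<j\le n$. *)

(* Defs.v *)
From mathcomp Require Import all_boot.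
Set Implicit Arguments.
Unset Strict Implicit.
Unset Printing Implicit Defensive.

(* A finite directed graph is a vertex type V : finType together with an
   arbitrary edge set E : {set V * V}; self-loops and V empty are allowed. *)

Definition passage (V : finType) (E P : {set V * V}) : bool :=
  (P \subset E) &&
  [forall x : V, forall y : V, ((x, y) \in P) ==>
    [forall x' : V, forall y' : V,
      (((x, y') \in E) && ((x', y) \in E)) ==>
      (((x, y') \in P) && ((x', y) \in P))]].

(* The empty set is a minimal passage in this sense. *)
Definition minimal_passage (V : finType) (E P : {set V * V}) : bool :=
  passage E P &&
  ~~ [exists P' : {set V * V},
        [&& passage E P', P' != set0 & P' \proper P]].

Definition pas_min (V : finType) (E : {set V * V}) : {set {set V * V}} :=
  [set P | (P != set0) && minimal_passage E P].

(* The library's partition covers nonemptiness of the blocks, union equal to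
   E, and pairwise disjointness. *)
Definition passage_partitioning (V : finType) (E : {set V * V})
    (PP : {set {set V * V}}) : bool :=
  [forall P in PP, passage E P] && partition PP E.

(* Main.v *)
Require Import Defs.
From mathcomp Require Import all_boot.

(** Passages are closed under intersection and difference. Closure under
intersection makes distinct non-empty minimal passages disjoint; closure under
difference makes an inclusion-minimal passage among those containing a given
edge a minimal passage, so every edge is covered. *)

(* Taking y' = y or x' = x in the definition separates the two conditions. *)
Lemma passageP (V : finType) (E P : {set V * V}) :
  reflect (P \subset E /\ forall e f, e \in P -> f \in E ->
             (e.1 == f.1) || (e.2 == f.2) -> f \in P)
          (passage E P).
Proof.
apply: (iffP andP) => -[sPE clP]; split=> //.
- move=> [x y] [x' y'] /= Pxy Ef; have Exy := subsetP sPE _ Pxy.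
  have {}clP x1 y1 : (x, y1) \in E -> (x1, y) \in E ->
      (x, y1) \in P /\ (x1, y) \in P.
    move=> E1 E2; move/forallP/(_ x)/forallP/(_ y): clP.
    rewrite Pxy => /forallP/(_ x1)/forallP/(_ y1).
    by rewrite E1 E2 => /andP.
  case/orP=> /eqP eq_f; rewrite -eq_f in Ef *.
    by case: (clP x y' Ef Exy).
  by case: (clP x' y Exy Ef).
- apply/forallP=> x; apply/forallP=> y; apply/implyP=> Pxy.
  apply/forallP=> x'; apply/forallP=> y'; apply/implyP=> /andP[E1 E2].
  by rewrite (clP _ _ Pxy E1) ?(clP _ _ Pxy E2) //= eqxx ?orbT.
Qed.

Lemma passage_self (V : finType) (E : {set V * V}) : passage E E.
Proof. by apply/passageP. Qed.

Lemma passageI (V : finType) (E P Q : {set V * V}) :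
  passage E P -> passage E Q -> passage E (P :&: Q).
Proof.
move=> /passageP[sPE clP] /passageP[_ clQ]; apply/passageP; split.
  exact: subset_trans (subsetIl P Q) sPE.
move=> e f /setIP[Pe Qe] Ef ef.
by rewrite inE (clP e f) // (clQ e f).
Qed.

(** Sharing a source or a target is a symmetric relation, so an edge outside [Q] cannot be linked to
    an edge of [Q]. *)
Lemma passageD (V : finType) (E P Q : {set V * V}) :
  passage E P -> passage E Q -> passage E (P :\: Q).
Proof.
move=> /passageP[sPE clP] /passageP[_ clQ]; apply/passageP; split.
  exact: subset_trans (subsetDl P Q) sPE.
move=> e f /setDP[Pe nQe] Ef ef; rewrite inE (clP e f) // andbT.
(* Closure of [Q] is used backwards, from [f] to [e]; this requires [e \in E], which comes from
   [P \subset E]. *)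
apply: contra nQe => Qf; apply: (clQ f e) => //.
  exact: (subsetP sPE).
by rewrite eq_sym [f.2 == _]eq_sym.
Qed.

(** Replacing proper inclusion by an equality lets minimality identify [P] with any non-empty
    passage found inside it. *)
Lemma pas_minP (V : finType) (E P : {set V * V}) :
  reflect [/\ P != set0, passage E P &
             forall Q, passage E Q -> Q != set0 -> Q \subset P -> Q = P]
          (P \in pas_min E).
Proof.
rewrite inE; apply: (iffP andP) => [[P0 /andP[pasP minP]]|[P0 pasP minP]].
  split=> // Q pasQ Q0 sQP; apply/eqP; apply: contraR minP => neqQP.
  by apply/existsP; exists Q; rewrite pasQ Q0 properEneq neqQP.
split=> //; rewrite /minimal_passage pasP /=.
apply/existsP=> -[Q /and3P[pasQ Q0 ltQP]].
by have := ltQP; rewrite (minP Q pasQ Q0 (proper_sub ltQP)) properxx.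
Qed.

Lemma pas_min_cover (V : finType) (E : {set V * V}) e :
  e \in E -> exists2 P, P \in pas_min E & e \in P.
Proof.
move=> Ee; pose pas_e P := passage E P && (e \in P).
have pasE : pas_e E by rewrite /pas_e passage_self.
have [P /minsetP[/andP[pasP Pe] minP] _] := minset_exists pasE.
exists P => //; apply/pas_minP; split=> //; first by apply/set0Pn; exists e.
(* So far [P] is minimal only among passages containing [e], so a [Q] that misses [e] needs a
   separate argument. *)
move=> Q pasQ Q0 sQP; have [Qe | nQe] := boolP (e \in Q).
  by apply: minP => //; rewrite /pas_e pasQ.
(* Here [P :\: Q] still contains [e], so it equals [P]; then [Q] is both disjoint from [P] and
   inside it, hence empty. *)
have /minP : pas_e (P :\: Q) by rewrite /pas_e passageD // inE nQe.
move/(_ (subsetDl _ _))/setDidPl; rewrite disjoint_sym => /disjoint_setI0.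
by rewrite (setIidPl sQP) => Q_0; rewrite Q_0 eqxx in Q0.
Qed.

Theorem mainTheorem6 (V : finType) (E : {set V * V}) :
  passage_partitioning E (pas_min E).
Proof.
apply/andP; split; first by apply/forall_inP=> P /pas_minP[].
apply/and3P; split; last by apply/negP=> /pas_minP[/eqP].
- apply/eqP/setP=> e; apply/bigcupP/idP=> [[P /pas_minP[_ pasP _] Pe] | Ee].
    by have /passageP[/subsetP sPE _] := pasP; exact: sPE.
  by have [P minP Pe] := pas_min_cover _ _ _ Ee; exists P.
- apply/trivIsetP=> P Q /pas_minP[_ pasP minP] /pas_minP[_ pasQ minQ].
  (* A non-empty [P :&: Q] is a passage inside both blocks, so minimality of each gives
     [P = P :&: Q = Q]. *)
  rewrite -setI_eq0; apply: contraR => PQ0.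
  have pasPQ := passageI _ _ _ _ pasP pasQ.
  by rewrite -{1}(minP _ pasPQ PQ0 (subsetIl P Q))
    (minQ _ pasPQ PQ0 (subsetIr P Q)).
Qed.
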